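(* Let $v\geq\sqrt{5/3}$ and let $u$ satisfy $\max\{v,\,(11v-4\sqrt{6v^2-10})/5\}\leq u\leq v+2/v$. For any unimodal random variable $Z$ with mean $0$ and variance $1$, the inequality $$P(Z\leq -u \text{ or } Z\geq v)\leq \frac49\;\frac{4+(u-v)^2}{(u+v)^2}$$ holds, with equality if $Z=(v-u)/2+UY$, where $U$ and $Y$ are independent random variables, $U$ is uniform on the unit interval, and $Y$ takes the values $$-\tfrac34(u+v),\qquad 0,\qquad \tfrac34(u+v)$$ with probabilities $$\frac43\,\frac{2+v(v-u)}{(u+v)^2},\qquad 1-\frac43\,\frac{4+(v-u)^2}{(u+v)^2},\qquad \frac43\,\frac{2+u(u-v)}{(u+v)^2},$$ respectively.
   Context: A distribution on $\mathbb{R}$ is unimodal with mode at $M$ if its distribution function is convex on $(-\infty,M)$ and concave on $[M,\infty)$; it is unimodal if this holds for some real $M$. (A unimodal distribution may thus have an atom, but only at the mode $M$.) *)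

(* Defs.v *)
From HB Require Import structures.
From mathcomp Require Import all_boot all_order all_algebra.
From mathcomp Require Import all_classical all_reals all_analysis.

Set Implicit Arguments.
Unset Strict Implicit.
Unset Printing Implicit Defensive.

Import Order.TTheory GRing.Theory Num.Theory.
Import numFieldNormedType.Exports.

Local Open Scope classical_set_scope.
Local Open Scope ring_scope.

Definition concave_function (R : realType) (D : set R) (f : R -> R) : Prop :=
  @convex_function R R^o D (fun x => - f x).

(* [cdf] is \bar R-valued; it is always finite, so [fine] loses nothing. *)
Definition distribution_function d (T : measurableType d) (R : realType)
    (P : probability T R) (X : {RV P >-> R}) : R -> R :=
  fun r => fine (cdf X r).

Definition unimodal_at d (T : measurableType d) (R : realType)
    (P : probability T R) (X : {RV P >-> R}) (M : R) : Prop :=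
  @convex_function R R^o `]-oo, M[ (distribution_function X) /\
  concave_function `[M, +oo[ (distribution_function X).

Definition unimodal d (T : measurableType d) (R : realType)
    (P : probability T R) (X : {RV P >-> R}) : Prop :=
  exists M : R, unimodal_at X M.

Definition independent_RVs d (T : measurableType d) (R : realType)
    (P : probability T R) (X Y : {RV P >-> R}) : Prop :=
  forall A B : set R, measurable A -> measurable B ->
    P (X @^-1` A `&` Y @^-1` B) = (P (X @^-1` A) * P (Y @^-1` B))%E.

Definition uniform01 d (T : measurableType d) (R : realType)
    (P : probability T R) (X : {RV P >-> R}) : Prop :=
  forall A : set R, measurable A ->
    distribution P X A = uniform_prob (@ltr01 R) A.

(* Main.v *)
Require Import Defs.
From HB Require Import structures.
From mathcomp Require Import all_boot all_order all_algebra.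
From mathcomp Require Import all_classical all_reals all_analysis.
From mathcomp Require Import measurable_realfun.
From mathcomp Require Import ring lra.

Set Implicit Arguments.
Unset Strict Implicit.
Unset Printing Implicit Defensive.

Import Order.TTheory GRing.Theory Num.Theory.
Import numFieldNormedType.Exports.

Local Open Scope classical_set_scope.
Local Open Scope ring_scope.

(** The inequality is a case of the Vysochanskij-Petunin inequality.  Put
    [m = (v - u) / 2] and [r = (u + v) / 2].  The event is [r <= |Z - m|], the
    second moment of [Z - m] is [1 + m^2], and the hypotheses on [u] and [v]
    imply that [r^2 >= (8/3) (1 + m^2)] ([interval_condition]).  In this range,
    among the two terms of the bound
      [P (|Z - m| >= r) <= max (4/9 B) ((4 B - 1) / 3)],
      [B = E (Z - m)^2 / r^2],
    the first one, of Gauss type, is the larger, and [4/9 B] is the claimed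
    value.

    The Vysochanskij-Petunin inequality is proved by duality, without
    densities.  Unimodality at [M] enters only through the domination
      [P (X in A) <= t P (M + t (X - M) in A)]  for all [t > 1]
    and all Borel sets [A] ([unimodal_dilation]).  On half-open intervals this
    is the monotonicity of slopes of the distribution function; it passes to
    Borel sets because [t F (M + (x - M) / t) - F x] is nondecreasing, hence
    the distribution function of a measure, the difference of both sides.

    Apply the domination to a function [psi >= 0], where [psi x] is the average
    over the segment from [M] to [x] of a gap function
    [h x = lam x^2 + c - 1_(|x| >= 1)].  Since [(x - M) psi x] is a primitive
    of [h], dividing [t psi (M + t (x - M)) - psi x] by [t - 1] and letting [t]
    tend to 1 gives back [h x].  So [E h(X) >= 0], that is,
    [P (|X| >= 1) <= lam E X^2 + c], as soon as all the averages of [h] over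
    segments with endpoint [M] are nonnegative ([spread_tail_bound]).  A
    reflection reduces to [0 <= M].  For [M < 1] the choice
    [lam = 4 / (9 - 6 M^2)], [c = - lam M^2 / 4] works, and for [1 <= M] the
    choice [lam = 4/3], [c = -1/3]; the proofs are cubic inequalities
    ([average_ge0_inner], [average_ge0_outer]).  For [M < 1] the line
    [lam B + c] passes through the crossing point [(3/8, 1/6)] of the lines
    [4/9 B] and [(4 B - 1) / 3] and has a slope between theirs, so it lies
    below their maximum.

    In the case of equality, conditioning on [Y] shows that the law of
    [Z = m + U Y] is a mixture of the uniform laws on [[m - a, m]] and
    [[m, m + a]], [a = 3/4 (u + v)], and of the unit mass at [m].  All
    quantities are then explicit: the distribution function is [pm] times a
    positive part on the left of [m], and [1] minus [pp] times a positive part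
    on the right.  The mean and the variance are read off from the second
    moments of [Z - c] for all [c]. *)

(** * Slopes of convex functions *)

Section convexity.
Context {R : realType}.
Implicit Types (D : set R) (f : R -> R).

Lemma convex_functionP D f :
  @convex_function R R^o D f <->
  forall t x y, 0 <= t <= 1 -> D x -> D y ->
    f (t * x + (1 - t) * y) <= t * f x + (1 - t) * f y.
Proof.
split=> [cf t x y t01 Dx Dy|cf t x y].
  have := cf (Itv01 (andP t01).1 (andP t01).2) x y.
  by rewrite !inE => /(_ Dx Dy); exact.
rewrite !inE => Dx Dy.
have t01 : 0 <= (t%:num : R) <= 1 by apply/andP; split; [exact: ge0|exact: le1].
exact: (cf _ x y t01 Dx Dy).
Qed.

Lemma convex_chord D f a p c : @convex_function R R^o D f -> D a -> D c ->
  a <= p -> p <= c -> (c - a) * f p <= (c - p) * f a + (p - a) * f c.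
Proof.
move=> /convex_functionP cf Da Dc ap pc.
have [ac|ac] := eqVneq a c.
  have -> : p = a by apply/eqP; rewrite eq_le ap ac pc.
  by rewrite ac; lra.
have ca : 0 < c - a by rewrite subr_gt0 lt_neqAle ac (le_trans ap pc).
have := cf ((c - p) / (c - a)) a c _ Da Dc.
have -> : (c - p) / (c - a) * a + (1 - (c - p) / (c - a)) * c = p.
  by field; rewrite gt_eqF.
move=> /(_ _)/(ler_wpM2l (ltW ca)) H; apply: le_trans (H _) _.
  by apply/andP; split; [apply: divr_ge0; lra|rewrite ler_pdivrMr//; lra].
by rewrite le_eqVlt; apply/orP; left; apply/eqP; field; rewrite gt_eqF.
Qed.

(** Both slopes are compared with the slope over the hull [[a1, b2]], which is
    at least the slope over [[a1, b1]] and at most the one over [[a2, b2]]. *)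
Lemma convex_slope D f a1 b1 a2 b2 : @convex_function R R^o D f ->
  D a1 -> D b2 -> a1 <= a2 -> b1 <= b2 -> a1 < b1 -> a2 < b2 ->
  (b2 - a2) * (f b1 - f a1) <= (b1 - a1) * (f b2 - f a2).
Proof.
move=> cf Da Db aa bb ab1 ab2.
have h1 := convex_chord cf Da Db (ltW ab1) bb.
have h2 := convex_chord cf Da Db aa (ltW ab2).
have ba : 0 < b2 - a1 by lra.
rewrite -(ler_pM2l ba).
have {h1} : (b2 - a1) * (f b1 - f a1) <= (b1 - a1) * (f b2 - f a1) by lra.
have {h2} : (b2 - a2) * (f b2 - f a1) <= (b2 - a1) * (f b2 - f a2) by lra.
have {ab1} : 0 < b1 - a1 by lra.
have {ab2} : 0 < b2 - a2 by lra.
move: (b2 - a2) (b1 - a1) (b2 - a1) ba => A B C C0 A0 B0 h1 h2.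
have := ler_wpM2l (ltW A0) h2.
have := ler_wpM2l (ltW B0) h1.
by lra.
Qed.

(** Scaling towards [M] by [1 / t] moves an interval closer to [M], where the
    slope of [f] is larger, and divides its length by [t]; so the increments of
    the first term dominate those of the second on each side of [M].  Across
    [M] the function [f] may jump upwards, which only helps since [t > 1]. *)
Lemma dilation_increment f M t : {homo f : x y / x <= y} ->
    @convex_function R R^o `]-oo, M[ f -> concave_function `[M, +oo[ f ->
  1 < t -> {homo (fun x => t * f (M + (x - M) / t) - f x) : x y / x <= y}.
Proof.
move=> ndf cvx ccv t1; have t0 : 0 < t by lra.
set s := fun x => M + (x - M) / t; set g := fun x => t * f (s x) - f x.
have sE x : x = M + t * (s x - M) by rewrite /s; field; rewrite gt_eqF.
have sB x y : y - x = t * (s y - s x).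
  by rewrite {1}(sE x) {1}(sE y); ring.
have left x y : x < y -> y < M -> g x <= g y.
  move=> xy yM.
  have sxy : s x < s y by have := sB x y; nra.
  have xs : x <= s x by have := sE x; nra.
  have ys : y <= s y by have := sE y; nra.
  have sM : s y < M by have := sE y; nra.
  have /= := @convex_slope _ _ _ _ _ _ cvx _ _ xs ys xy sxy.
  rewrite !in_itv/= => /(_ (lt_trans xy yM) sM).
  rewrite (sB x y) mulrAC -subr_ge0 => h.
  suff : 0 <= (s y - s x) * (g y - g x).
    by rewrite pmulr_rge0 ?subr_ge0 ?subr_gt0.
  by rewrite /g; lra.
have right x y : x < y -> M <= x -> g x <= g y.
  move=> xy xM.
  have sxy : s x < s y by have := sB x y; nra.
  have xs : s x <= x by have := sE x; nra.
  have ys : s y <= y by have := sE y; nra.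
  have sM : M <= s x by have := sE x; nra.
  have /= := @convex_slope _ _ _ _ _ _ ccv _ _ xs ys sxy xy.
  rewrite !in_itv/= !andbT => /(_ sM (le_trans xM (ltW xy))).
  rewrite (sB x y) -subr_ge0 => h.
  suff : 0 <= (s y - s x) * (g y - g x).
    by rewrite pmulr_rge0 ?subr_ge0 ?subr_gt0.
  by rewrite /g; lra.
(* [f] is convex only on the left of [M]: the slope inequality is used up to
   [z < M], and [z] tends to [M] with [f z] bounded by [f M]. *)
have mid x : x < M -> g x <= g M.
  move=> xM.
  have sM : s M = M by rewrite /s subrr mul0r addr0.
  have xs : x < s x by have := sE x; nra.
  have sxM : s x < M by have := sE x; nra.
  have chord z : s x < z -> z < M ->
      (f (s x) - f x) * (z - s x) <= (s x - x) * (f M - f (s x)).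
    move=> sz zM.
    have /= := @convex_slope _ _ _ _ _ _ cvx _ _ (ltW xs) (ltW sz) xs sz.
    rewrite !in_itv/= => /(_ xM zM) h.
    have := ndf _ _ (ltW zM); nra.
  have : (f (s x) - f x) * (M - s x) <= (s x - x) * (f M - f (s x)).
    apply/ler_addgt0Pr => e e0.
    have k0 : 0 <= f (s x) - f x by rewrite subr_ge0 ndf// ltW.
    set k := f (s x) - f x in k0 *.
    pose w := Num.min ((M - s x) / 2) (e / (k + 1)).
    have w0 : 0 < w by rewrite lt_min !divr_gt0//; lra.
    have we : w * (k + 1) <= e.
      by rewrite -ler_pdivlMr ?ge_min ?lexx ?orbT//; lra.
    have wM : w <= (M - s x) / 2 by rewrite ge_min lexx.
    have := chord (M - w); rewrite -/k => /(_ _ _); nra.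
  have -> : s x - x = (t - 1) * (M - s x) by rewrite {2}(sE x); ring.
  rewrite -subr_ge0 => h.
  suff : 0 <= (M - s x) * (g M - g x).
    by rewrite pmulr_rge0 ?subr_ge0 ?subr_gt0.
  by rewrite /g sM; lra.
move=> x y; rewrite le_eqVlt => /orP[/eqP->//|xy].
have [yM|My] := ltP y M; first exact: left.
have [xM|Mx] := ltP x M; last exact: right.
apply: (le_trans (mid _ xM)).
move: My; rewrite le_eqVlt => /orP[/eqP->//|My]; exact: right.
Qed.

End convexity.

(** * Unimodal laws are dominated by their dilations *)

Definition affine (T : Type) (R : realType) (a b : R) (X : T -> R) : T -> R :=
  fun w => a * X w + b.

Section affine_measurable.
Context d (T : measurableType d) (R : realType) (a b : R) (X : {mfun T >-> R}).

Lemma measurable_affine : measurable_fun setT (affine a b X).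
Proof. by apply: measurable_funD => //; exact: measurable_funM. Qed.

HB.instance Definition _ := isMeasurableFun.Build _ _ _ _ (affine a b X)
  measurable_affine.

End affine_measurable.

Section dilation.
Context d (T : measurableType d) (R : realType) (P : probability T R).
Implicit Types X : {RV P >-> R}.

Lemma distribution_function_nondecreasing X :
  {homo distribution_function X : x y / x <= y}.
Proof.
by move=> x y xy; rewrite fine_le ?fin_num_measure// cdf_nondecreasing.
Qed.

Lemma distribution_function_right_continuous X :
  right_continuous (distribution_function X).
Proof.
move=> a; apply: fine_cvg.
by rewrite fineK ?fin_num_measure//; exact: cdf_right_continuous.
Qed.

Lemma distribution_itv X a b : a <= b ->
  distribution P X `]a, b] =
  (distribution_function X b - distribution_function X a)%:E.
Proof.
move=> ab; rewrite EFinB !fineK ?fin_num_measure// /cdf.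
have -> : `]a, b]%classic = `]-oo, b] `\` `]-oo, a] :> set R.
  by rewrite -[RHS]setCK setCD setCitvl setUC -[LHS]setCK setCitv.
rewrite measureD ?setIidr//; first exact: subset_itvl.
by rewrite -ge0_fin_numE// fin_num_measure.
Qed.

Lemma distribution_function_affine X a b x : 0 < a ->
  distribution_function (affine a b X : {RV P >-> R}) x =
  distribution_function X ((x - b) / a).
Proof.
move=> a0; congr (fine (P _)); apply/seteqP; split=> w /=;
  by rewrite !in_itv/= ler_pdivlMr// /affine lerBrDr mulrC.
Qed.

Lemma lebesgue_stieltjes_itv (f : cumulative R R) a b : a <= b ->
  lebesgue_stieltjes_measure f `]a, b] = (f b - f a)%:E.
Proof.
move=> ab; rewrite /lebesgue_stieltjes_measure /measure_extension/=.
by rewrite measurable_mu_extE/= ?wlength_itv_bnd//; exact: is_ocitv.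
Qed.

Section unimodal_dilation.
Variables (X : {RV P >-> R}) (M t : R).
Hypotheses (uX : unimodal_at X M) (t1 : 1 < t).

Let t0 : 0 < t. Proof. exact: lt_trans ltr01 t1. Qed.
Let Y : {RV P >-> R} := affine t ((1 - t) * M) X.
Let F := distribution_function X.
Let K x := t * distribution_function Y x.
Let G x := K x - F x.

Let KE x : K x = t * F (M + (x - M) / t).
Proof.
rewrite /K distribution_function_affine//; congr (_ * F _).
by field; rewrite gt_eqF.
Qed.

Let K_nd : nondecreasing K.
Proof.
move=> x y xy; rewrite ler_pM2l//; exact: distribution_function_nondecreasing.
Qed.

Let K_rc : right_continuous K.
Proof.
move=> x; apply: cvgM; first exact: cvg_cst.
exact: distribution_function_right_continuous.
Qed.

Let G_nd : nondecreasing G.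
Proof.
move=> x y xy; rewrite /G !KE.
apply: (@dilation_increment _ F M t _ uX.1 uX.2 t1 x y xy).
exact: distribution_function_nondecreasing.
Qed.

Let G_rc : right_continuous G.
Proof.
move=> x; apply: cvgB; first exact: K_rc.
exact: distribution_function_right_continuous.
Qed.

(* Lebesgue-Stieltjes measures live on [measurableTypeR R], a copy of [R] with
   another display, to which the laws of [X] and [Y] are transported. *)
Let idRT : R -> measurableTypeR R := idfun.

#[local] HB.instance Definition _ :=
  @isMeasurableFun.Build _ _ _ _ idRT (@measurable_id _ _ setT).

#[local] HB.instance Definition _ := isCumulative.Build R _ R K K_nd K_rc.
#[local] HB.instance Definition _ := isCumulative.Build R _ R G G_nd G_rc.

(** Here [Y = M + t (X - M)], so [K] is [t] times its distribution function.
    As [G = K - F] is a distribution function too, the Lebesgue-Stieltjes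
    measure of [K] is both [t] times the law of [Y] and the sum of the law of
    [X] and of the measure of [G]. *)
Lemma unimodal_dilation A : measurable A ->
  (distribution P X A <= t%:E * distribution P Y A)%E.
Proof.
move=> mA.
pose tY := mscale (NngNum (ltW t0)) (distribution (distribution P Y) idRT).
pose XG := measure_add (distribution (distribution P X) idRT)
  (lebesgue_stieltjes_measure G).
have XGE B : XG B = (distribution P X B + lebesgue_stieltjes_measure G B)%E.
  exact: measure_addE.
have KY : lebesgue_stieltjes_measure K A = tY A.
  apply: lebesgue_stieltjes_measure_unique => // I [[a b] _ <-]/=.
  have [ab|ba] := leP a b; last first.
    by rewrite set_itv_ge ?measure0// bnd_simp -leNgt ltW.
  rewrite lebesgue_stieltjes_itv//= /tY/mscale/= distribution_itv// -EFinM.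
  by rewrite mulrBr.
have KX : lebesgue_stieltjes_measure K A = XG A.
  apply: lebesgue_stieltjes_measure_unique => // I [[a b] _ <-].
  have [ab|ba] := leP a b; last first.
    by rewrite set_itv_ge ?measure0// bnd_simp -leNgt ltW.
  apply: (eq_trans _ (esym (XGE _))).
  rewrite !lebesgue_stieltjes_itv// distribution_itv// -EFinD.
  congr EFin; have e (x y z w : R) : x - y = z - w + (x - z - (y - w)) by ring.
  exact: e.
have : tY A = XG A by rewrite -KY.
rewrite XGE /tY /mscale/= => ->.
by rewrite leeDl.
Qed.

End unimodal_dilation.

End dilation.

(** * Averages of the gap function *)

Section window.
Context {R : realType}.
Implicit Types (lam c M x e r : R).

(** The signed length of the part of the segment from [M] to [x] that lies
    outside the interval [(-1, 1)], for [0 <= M]. *)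
Definition outside M x : R :=
  Num.max (x - 1) 0 - Num.max (- 1 - x) 0 - Num.max (M - 1) 0.

(** The average, over the segment from [M] to [x], of the gap function
    [h z = lam z^2 + c - 1_(|z| >= 1)].  The segment degenerates for [x = M],
    where the law may have an atom; the value is then [h M]. *)
Definition average lam c M x : R :=
  if x == M then lam * M ^+ 2 + c - (1 <= M)%R%:R
  else lam * (x ^+ 2 + x * M + M ^+ 2) / 3 + c - outside M x / (x - M).

Lemma outside_le M x y : x <= y -> outside M x <= outside M y.
Proof.
move=> xy; rewrite /outside /Order.max.
do 5!case: ltP => ?; lra.
Qed.

Lemma outside_diff M x y : (1 <= x) && (1 <= y) || (x <= -1) && (y <= -1) ->
  outside M y - outside M x = y - x.
Proof.
move=> h; rewrite /outside /Order.max.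
case/orP: h => /andP[h1 h2].
  have -> : (y - 1 < 0) = false by apply/negbTE; rewrite -leNgt; lra.
  have -> : (x - 1 < 0) = false by apply/negbTE; rewrite -leNgt; lra.
  have -> : (- 1 - y < 0) by lra.
  have -> : (- 1 - x < 0) by lra.
  by ring.
have -> : (- 1 - y < 0) = false by apply/negbTE; rewrite -leNgt; lra.
have -> : (- 1 - x < 0) = false by apply/negbTE; rewrite -leNgt; lra.
have -> : (y - 1 < 0) by lra.
have -> : (x - 1 < 0) by lra.
by ring.
Qed.

Lemma outside_itv M x : -1 <= x <= 1 -> outside M x = - Num.max (M - 1) 0.
Proof.
move=> /andP[h1 h2].
have px : Num.max (x - 1) 0 = 0 by apply: max_r; lra.
have nx : Num.max (- 1 - x) 0 = 0 by apply: max_r; lra.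
by rewrite /outside px nx subrr sub0r.
Qed.

(** The expression [(x - M) * average lam c M x] is a primitive of the gap
    function [h], so [(1 + e)] times the average at [x + e * (x - M)] exceeds
    the average at [x] by [e] times the mean of [h] between these two points.
    For the quadratic part of [h] this mean is its value at [x] up to a term of
    order [e].  The indicator is not continuous: a point [x] with [r <= |x|]
    must still satisfy [1 <= |x|] after the move.  Among these, only points
    between [r] and [M] move towards [0], by at most [e * M <= r - 1]. *)
Lemma average_step lam c M e r x : 0 <= lam -> 0 <= M -> 0 < e <= 1 ->
  e * M <= r - 1 ->
  (1 + e) * average lam c M (x + e * (x - M)) + e * (r <= `|x|)%R%:R <=
  average lam c M x + e * (lam * x ^+ 2 + c + 3 * lam * e * (x ^+ 2 + M ^+ 2)).
Proof.
move=> l0 M0 /andP[e0 e1] eM; have r1 : 1 <= r by nra.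
rewrite /average; have [->|xM] := eqVneq x M.
  rewrite subrr mulr0 addr0 eqxx ger0_norm//.
  have : (r <= M)%R%:R <= (1 <= M)%R%:R :> R.
    by rewrite ler_nat; case: (leP r M) => // /(le_trans r1) ->.
  have : 0 <= e * (lam * e * (M ^+ 2)).
    by rewrite !mulr_ge0// ?sqr_ge0// ltW.
  by nra.
have xM0 : x - M != 0 by rewrite subr_eq0.
have -> : (x + e * (x - M) == M) = false.
  apply/negbTE; rewrite -subr_eq0.
  have -> : x + e * (x - M) - M = (1 + e) * (x - M) by ring.
  by rewrite mulf_neq0//; lra.
set y := x + e * (x - M).
have J : e * (r <= `|x|)%R%:R <= (outside M y - outside M x) / (x - M).
  have [rx|rx] := leP r `|x|.
    rewrite mulr1 outside_diff; first by rewrite /y addrAC subrr add0r mulfK.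
    have eM0 := mulr_ge0 (ltW e0) M0.
    move: rx; rewrite ler_normr => /orP[rx|rx]; rewrite /y; apply/orP.
      have ex : 0 <= e * x by apply: mulr_ge0; lra.
      by left; apply/andP; split; lra.
    have ex : 0 <= e * - x by apply: mulr_ge0; lra.
    by right; apply/andP; split; lra.
  rewrite mulr0; have [xM1|xM1] := ltP x M.
    rewrite mulr_le0// ?invr_le0 ?subr_le0 ?(ltW xM1)//; apply: outside_le.
    by rewrite /y; nra.
  rewrite mulr_ge0// ?invr_ge0 ?subr_ge0//; apply: outside_le.
  by rewrite /y; nra.
have Q : 0 <= 3 * (x ^+ 2 + M ^+ 2) - x * (x - M) - e / 3 * (x - M) ^+ 2.
  suff : (x - M) ^+ 2 * e <= (x - M) ^+ 2 by nra.
  by rewrite ler_piMr// sqr_ge0.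
have -> : (1 + e) * (lam * (y ^+ 2 + y * M + M ^+ 2) / 3 + c -
    outside M y / (y - M)) = lam * (x ^+ 2 + x * M + M ^+ 2) / 3 + c
  + e * (lam * x ^+ 2 + c) + e * e * lam * x * (x - M)
  + e * e * e * lam * (x - M) ^+ 2 / 3 - outside M y / (x - M).
  rewrite /y; field; rewrite xM0/=.
  by rewrite (_ : _ - _ = (1 + e) * (x - M)); [rewrite mulf_neq0//; lra|ring].
have := mulr_ge0 (mulr_ge0 l0 (mulr_ge0 (ltW e0) (ltW e0))) Q.
rewrite mulrBl in J.
lra.
Qed.

Lemma average_le lam c M x : 0 <= lam -> 0 <= M ->
  average lam c M x <= lam * (x ^+ 2 + M ^+ 2) + `|c|.
Proof.
move=> l0 M0; have := ler_norm c => cc.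
have := mulr_ge0 l0 (sqr_ge0 M) => lM.
have := mulr_ge0 l0 (sqr_ge0 x) => lx.
have := mulr_ge0 l0 (sqr_ge0 (x - M)) => lxM.
rewrite /average; have [->|xM] := eqVneq x M.
  have : 0 <= (1 <= M)%R%:R :> R by [].
  by lra.
suff : 0 <= outside M x / (x - M) by lra.
have out0 : outside M M = 0.
  by rewrite /outside [X in _ - X - _]max_r ?subr0 ?subrr//; lra.
have -> : outside M x = outside M x - outside M M by rewrite out0 subr0.
have [xM1|xM1] := ltP x M.
  by rewrite mulr_le0// ?invr_le0 ?subr_le0 ?(ltW xM1)//; apply/outside_le/ltW.
by rewrite mulr_ge0// ?invr_ge0 ?subr_ge0//; apply: outside_le.
Qed.

(** With this [c], the average of the quadratic part is the multiple
    [lam (x + M / 2)^2 / 3] of a square: it touches zero at [x = - M / 2].  On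
    [|x| > 1] the claim follows from [cubic] at [y = |x|], whose two sides
    differ at [M = 0] by [(2 y - 3)^2 (y + 3)] and at [M = 1] by
    [4 (y - 1)^2 (y + 2)]. *)
Lemma average_ge0_inner M x (lam := 4 / (9 - 6 * M ^+ 2)) : 0 <= M < 1 ->
  0 <= average lam (- lam * M ^+ 2 / 4) M x.
Proof.
move=> /andP[M0 M1].
have d0 : 0 < 9 - 6 * M ^+ 2 by nra.
have lamE : lam * (9 - 6 * M ^+ 2) = 4 by rewrite /lam divfK// gt_eqF.
have l0 : 0 <= lam by rewrite divr_ge0// ltW.
rewrite /average; have [_|xM] := eqVneq x M.
  have -> : (1 <= M) = false by rewrite leNgt M1.
  by rewrite subr0; have := mulr_ge0 l0 (sqr_ge0 M); lra.
have cubic y : 1 <= y ->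
    (27 - 18 * M ^+ 2) * (y - 1) <= 4 * y ^+ 3 - 3 * M ^+ 2 * y - M ^+ 3.
  move=> y1.
  have h1 : 0 <= 4 * y ^+ 3 - 27 * y + 27.
    have -> : 4 * y ^+ 3 - 27 * y + 27 = (2 * y - 3) ^+ 2 * (y + 3) by ring.
    by rewrite mulr_ge0 ?sqr_ge0//; lra.
  have h2 : 0 <= 4 * y ^+ 3 - 12 * y + 8.
    have -> : 4 * y ^+ 3 - 12 * y + 8 = 4 * (y - 1) ^+ 2 * (y + 2) by ring.
    by rewrite !mulr_ge0 ?sqr_ge0//; lra.
  (* The gap between the two sides is at least the combination of [h1] and
     [h2] with weights [1 - M ^+ 2] and [M ^+ 2]. *)
  have m1 : 0 <= 1 - M ^+ 2 by nra.
  have m2 : 0 <= M ^+ 2 * (1 - M) by rewrite mulr_ge0 ?sqr_ge0//; lra.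
  have := mulr_ge0 m1 h1; have := mulr_ge0 (sqr_ge0 M) h2.
  by lra.
rewrite subr_ge0.
have -> : lam * (x ^+ 2 + x * M + M ^+ 2) / 3 + - lam * M ^+ 2 / 4 =
  lam * (x + M / 2) ^+ 2 / 3 by field.
have sq : 0 <= lam * (x + M / 2) ^+ 2 / 3.
  by rewrite divr_ge0// mulr_ge0// sqr_ge0.
have outM : outside M 1 = 0 by rewrite outside_itv ?max_r; lra.
have outN : outside M (-1) = 0 by rewrite outside_itv ?max_r; lra.
have [x1|x1] := ltP 1 x.
  have -> : outside M x = x - 1.
    by rewrite -(@outside_diff M 1 x) ?outM ?subr0 ?lexx ?(ltW x1).
  rewrite ler_pdivrMr; last lra.
  have := ler_wpM2l l0 (cubic x (ltW x1)); nra.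
have [x2|x2] := ltP x (-1).
  have -> : outside M x = x - (-1).
    by rewrite -(@outside_diff M (-1) x) ?outN ?subr0 ?lexx ?(ltW x2) ?orbT.
  rewrite -mulrNN -invrN ler_pdivrMr; last lra.
  have := ler_wpM2l l0 (cubic (- x) _).
  have := mulr_ge0 l0 (exprn_ge0 3 M0); nra.
by rewrite outside_itv ?x1 ?x2// max_r ?oppr0 ?mul0r//; lra.
Qed.

(** After multiplication by [M - x], the claim for [x <= 1] separates into a
    polynomial in [M], nonnegative by [cubic], and a polynomial in [x], which
    on [[-1, 1]] is [(1 - x) (2 x + 1)^2 / 9].  Equality holds for [M = 1],
    [x = - 1 / 2]. *)
Lemma average_ge0_outer M x : 1 <= M -> 0 <= average (4 / 3) (- (1 / 3)) M x.
Proof.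
move=> M1; rewrite /average; have [_|xM] := eqVneq x M.
  by rewrite M1 (_ : true%:R = 1)//; nra.
have cubic (y : R) : 0 <= y -> 0 <= 4 / 9 * (y ^+ 3 - 3 * y + 2).
  move=> y0; have -> : y ^+ 3 - 3 * y + 2 = (y - 1) ^+ 2 * (y + 2) by ring.
  apply: mulr_ge0; first lra.
  by rewrite mulr_ge0 ?sqr_ge0//; lra.
have cM := cubic M (le_trans ler01 M1).
have outM : outside M M = 0.
  by rewrite /outside [X in _ - X - _]max_r ?subr0 ?subrr//; lra.
rewrite subr_ge0; have [x1|x1] := leP 1 x.
  have -> : outside M x = x - M.
    by rewrite -(@outside_diff M M x) ?outM ?subr0 ?x1 ?M1.
  by rewrite divff ?subr_eq0//; nra.
rewrite -mulrNN -invrN ler_pdivrMr; last lra.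
have [x2|x2] := ltP x (-1).
  have outN : outside M (-1) = - (M - 1) by rewrite outside_itv ?max_l; lra.
  have -> : outside M x = x - (-1) - (M - 1).
    by rewrite -(@outside_diff M (-1) x) ?outN ?lexx ?(ltW x2) ?orbT//; ring.
  by have := cubic (- x); nra.
rewrite outside_itv ?x2 ?(ltW x1)// max_l; last lra.
have : 0 <= (1 - x) * (2 * x + 1) ^+ 2 by rewrite mulr_ge0 ?sqr_ge0//; lra.
by nra.
Qed.

Lemma measurable_average lam c M : measurable_fun setT (average lam c M).
Proof.
have -> : setT = [set M] `|` ~` [set M] :> set R by rewrite setUv.
have mC : measurable (~` [set M] : set R) by exact: measurableC.
apply/measurable_funU => //; split.
  apply: (@eq_measurable_fun _ _ _ _ _ (cst (average lam c M M))) => //.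
  by move=> x; rewrite inE => ->.
pose f x := lam * (x ^+ 2 + x * M + M ^+ 2) / 3 + c - outside M x / (x - M).
apply: (@eq_measurable_fun _ _ _ _ _ f).
  by move=> x; rewrite inE /= /average => /eqP/negbTE ->.
have mid D : measurable_fun D (@idfun R) by exact: measurable_id.
rewrite /f; apply: measurable_funB.
  apply: measurable_funD => //; apply: measurable_funM => //.
  apply: measurable_funM => //; apply: measurable_funD => //.
  apply: measurable_funD; first exact: measurable_funX.
  exact: measurable_funM.
apply: measurable_funM.
  rewrite /outside; apply: measurable_funB => //; apply: measurable_funB.
    by apply: measurable_maxr => //; exact: measurable_funB.
  by apply: measurable_maxr => //; exact: measurable_funB.
apply: open_continuous_measurable_fun.
  apply/closed_openC/accessible_closed_set1/hausdorff_accessible.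
  exact: Rhausdorff.
move=> x; rewrite inE/= => xM.
apply: cvgV; first by rewrite subr_eq0; exact/eqP.
by apply: cvgB; [exact: cvg_id|exact: cvg_cst].
Qed.
End window.

(** * The Vysochanskij-Petunin inequality *)

Section spread.
Context d (T : measurableType d) (R : realType) (P : probability T R).
Implicit Types X : {RV P >-> R}.

(** What the proof needs of unimodality at [M].  Unlike the conditions on the
    distribution function, it is visibly stable under affine maps, reflections
    included. *)
Definition spread_from X (M : R) := forall t : R, 1 < t ->
  forall A, measurable A ->
  (distribution P X A <=
   t%:E * distribution P (affine t ((1 - t) * M) X : {RV P >-> R}) A)%E.

Lemma unimodal_spread X M : unimodal_at X M -> spread_from X M.
Proof. by move=> uX t t1 A mA; exact: unimodal_dilation. Qed.

Lemma spread_affine X M (a b : R) : spread_from X M ->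
  spread_from (affine a b X : {RV P >-> R}) (a * M + b).
Proof.
move=> sX t t1 A mA.
have mB : measurable ((fun x => a * x + b) @^-1` A).
  rewrite -[X in measurable X]setTI.
  have mid : measurable_fun setT (fun x : R => a * x + b).
    by apply: measurable_funD => //; exact: measurable_funM.
  exact: mid.
apply: (le_trans (sX t t1 _ mB)); rewrite le_eqVlt; apply/orP; left; apply/eqP.
congr (_ * P _)%E; apply/seteqP; split=> w /=; rewrite /affine;
  by congr A; ring.
Qed.

Lemma spread_integral X M t (f : R -> R) : spread_from X M -> 1 < t ->
  measurable_fun setT f -> (forall x, 0 <= f x) ->
  (\int[P]_w (f (X w))%:E <=
   t%:E * \int[P]_w (f (X w + (t - 1) * (X w - M)))%:E)%E.
Proof.
move=> sX t1 mf f0; pose Y : {RV P >-> R} := affine t ((1 - t) * M) X.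
have t0 : 0 <= t by lra.
have mf' : measurable_fun setT (EFin \o f) by exact/measurable_EFinP.
have intD (Z : {RV P >-> R}) :
    (\int[P]_w (f (Z w))%:E = \int[distribution P Z]_x (f x)%:E)%E.
  by rewrite (ge0_integral_distribution _ mf').
rewrite intD.
have -> : (\int[P]_w (f (X w + (t - 1) * (X w - M)))%:E =
           \int[distribution P Y]_x (f x)%:E)%E.
  rewrite -intD; apply: eq_integral => w _; congr (f _)%:E.
  by rewrite /Y/= /affine; ring.
rewrite -(@ge0_integral_mscale _ _ _ _ _ _ (NngNum t0))//.
by apply: ge0_le_measure_integral => // A mA; exact: sX.
by move=> x _; rewrite lee_fin. Qed.

Lemma integral_quadratic X (a b rho2 : R) : 0 <= a -> 0 <= b ->
  (\int[P]_w ((X w) ^+ 2)%:E = rho2%:E)%E ->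
  (\int[P]_w (a * (X w) ^+ 2 + b)%:E = (a * rho2 + b)%:E)%E.
Proof.
move=> a0 b0 h.
have mX2 : measurable_fun setT (fun w => ((X w) ^+ 2)%:E).
  exact/measurable_EFinP/measurable_funX.
under eq_integral do rewrite EFinD EFinM.
rewrite ge0_integralD//=; last 2 first.
- by move=> w _; rewrite -EFinM lee_fin mulr_ge0 ?sqr_ge0.
- by apply: emeasurable_funM => //; exact: measurable_cst.
rewrite ge0_integralZl//; last by move=> w _; rewrite lee_fin sqr_ge0.
by rewrite h integral_cst//= probability_setT mule1 -EFinM -EFinD.
Qed.

Lemma measurable_abs_ge X (r : R) : measurable [set w | r <= `|X w|].
Proof.
rewrite -[X in measurable X]setTI.
have -> : [set w | r <= `|X w|] = (Num.norm \o X) @^-1` `[r, +oo[.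
  by apply/seteqP; split=> w /=; rewrite in_itv/= andbT.
apply: (@measurableT_comp _ _ _ _ _ _ (@Num.norm R R)) => //.
Qed.

(** Integrating [average_step] and cancelling the finite integrals of the
    averages by [spread_integral] leaves the bound up to a term of order [e].
    The threshold [r] of the event exceeds the threshold [1] of the gap function
    because [average_step] needs room for [e > 0] when [M] lies beyond it. *)
Lemma spread_tail_bound X M (rho2 lam c r : R) :
  spread_from X M -> 0 <= M -> 0 <= lam ->
  (forall x, 0 <= average lam c M x) ->
  (\int[P]_w ((X w) ^+ 2)%:E = rho2%:E)%E -> 1 < r ->
  (P [set w | (r <= `|X w|)%R] <= (lam * rho2 + c)%:E)%E.
Proof.
move=> sX M0 l0 f0 X2 r1; set S := [set w | _].
have mS : measurable S by exact: measurable_abs_ge.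
have rho0 : 0 <= rho2.
  by rewrite -lee_fin -X2; apply: integral_ge0 => w _; rewrite lee_fin sqr_ge0.
have PS : (P S = (fine (P S))%:E) by rewrite fineK// fin_num_measure.
rewrite PS lee_fin; set p := fine (P S).
set f := average lam c M in f0 *.
have mf : measurable_fun setT f by exact: measurable_average.
have mfX : measurable_fun setT (fun w => (f (X w))%:E).
  exact/measurable_EFinP/measurableT_comp.
have fin : (\int[P]_w (f (X w))%:E)%E \is a fin_num.
  rewrite ge0_fin_numE; last by apply: integral_ge0 => w _; rewrite lee_fin.
  have b0 : 0 <= lam * M ^+ 2 + `|c| by rewrite addr_ge0// mulr_ge0// sqr_ge0.
  apply: (@le_lt_trans _ _
      (\int[P]_w (lam * (X w) ^+ 2 + (lam * M ^+ 2 + `|c|))%:E)%E).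
    apply: ge0_le_integral => //.
    - by move=> w _; rewrite lee_fin.
    - apply/measurable_EFinP; apply: measurable_funD => //.
      by apply: measurable_funM => //; exact: measurable_funX.
    - by move=> w _; rewrite lee_fin addrA -mulrDr; exact: average_le.
  by rewrite (integral_quadratic l0 b0 X2) ltry.
have step e : 0 < e <= 1 -> e * M <= r - 1 ->
    p <= lam * rho2 + c + 3 * lam * (rho2 + M ^+ 2) * e.
  move=> /andP[e0 e1] eM.
  have t1 : 1 < 1 + e by lra.
  have := spread_integral sX t1 mf f0; rewrite addrAC subrr add0r.
  have l3 : 0 <= e * (lam + 3 * lam * e).
    by rewrite mulr_ge0 ?addr_ge0 ?mulr_ge0// ltW.
  have m3 : 0 <= e * (c + `|c| + 3 * lam * e * M ^+ 2).
    apply: mulr_ge0; first exact: ltW.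
    apply: addr_ge0; first by have := ler_norm (- c); rewrite normrN; lra.
    by rewrite !mulr_ge0 ?sqr_ge0// ltW.
  have mfY : measurable_fun setT (fun w => (f (X w + e * (X w - M)))%:E).
    apply/measurable_EFinP; apply: (measurableT_comp mf).
    apply: measurable_funD => //; apply: measurable_funM => //.
    exact: measurable_funB.
  have : ((1 + e)%:E * (\int[P]_w (f (X w + e * (X w - M)))%:E) +
      (e * p + e * `|c|)%:E <= \int[P]_w (f (X w))%:E +
      (e * (lam + 3 * lam * e) * rho2 +
       e * (c + `|c| + 3 * lam * e * M ^+ 2))%:E)%E.
    rewrite -(integral_quadratic l3 m3 X2) -ge0_integralZl//; last 2 first.
    - by move=> w _; rewrite lee_fin.
    - by rewrite lee_fin; lra.
    have -> : (e * p + e * `|c|)%:E =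
        (\int[P]_w (e * \1_S w + e * `|c|)%:E)%E.
      under eq_integral do rewrite EFinD EFinM.
      rewrite ge0_integralD//=; last 3 first.
      - by move=> w _; rewrite -EFinM lee_fin mulr_ge0// ltW.
      - apply: emeasurable_funM => //; exact/measurable_EFinP.
      - by move=> _ _; rewrite lee_fin mulr_ge0// ltW.
      rewrite ge0_integralZl//; last 2 first.
      - exact/measurable_EFinP.
      - by rewrite lee_fin ltW.
      rewrite integral_indic// setIT integral_cst//=.
      by rewrite probability_setT mule1 PS.
    rewrite -ge0_integralD//; last 4 first.
    - by move=> w _; rewrite -EFinM lee_fin mulr_ge0//; lra.
    - by apply: emeasurable_funM.
    - by move=> w _; rewrite lee_fin addr_ge0// mulr_ge0// ltW.
    - apply/measurable_EFinP; apply: measurable_funD => //.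
      exact: measurable_funM.
    rewrite -ge0_integralD//; last 3 first.
    - by move=> w _; rewrite lee_fin.
    - by move=> w _; rewrite lee_fin addr_ge0// mulr_ge0 ?sqr_ge0.
    - apply/measurable_EFinP; apply: measurable_funD => //.
      by apply: measurable_funM => //; exact: measurable_funX.
    apply: ge0_le_integral => //.
    - move=> w _; rewrite -EFinM -EFinD lee_fin !addr_ge0// mulr_ge0//; lra.
    - apply: emeasurable_funD; first exact: emeasurable_funM.
      apply/measurable_EFinP; apply: measurable_funD => //.
      exact: measurable_funM.
    - apply: emeasurable_funD => //.
      apply/measurable_EFinP; apply: measurable_funD => //.
      by apply: measurable_funM => //; exact: measurable_funX.
    move=> w _; rewrite -EFinM -!EFinD lee_fin.
    have e01 : 0 < e <= 1 by rewrite e0.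
    have -> : \1_S w = (r <= `|X w|)%R%:R :> R.
      by rewrite indicE; congr (nat_of_bool _)%:R; apply/idP/idP;
        rewrite inE /S/=.
    by have := average_step c (X w) l0 M0 e01 eM; rewrite -/f; lra.
  (* The two infinite values of the integral of the moved average are
     excluded by the inequalities themselves. *)
  rewrite -(fineK fin); move: (fine _) (_ * _)%E => I [J| |]; last 2 first.
  - by [].
  - by [].
  rewrite -!EFinD !lee_fin => h1 h2.
  rewrite -(ler_pM2l e0); lra.
apply/ler_addgt0Pr => z z0.
pose k := 3 * lam * (rho2 + M ^+ 2).
have k0 : 0 <= k by rewrite !mulr_ge0// addr_ge0// sqr_ge0.
pose e := Num.min 1 (Num.min ((r - 1) / (M + 1)) (z / (k + 1))).
have e0 : 0 < e by rewrite !lt_min ltr01/= !divr_gt0//; lra.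
have e1 : e <= 1 by rewrite ge_min lexx.
have eM : e * (M + 1) <= r - 1.
  by rewrite -ler_pdivlMr ?ge_min ?lexx ?orbT//; lra.
have ek : e * (k + 1) <= z.
  by rewrite -ler_pdivlMr ?ge_min ?lexx ?orbT//; lra.
have := step e; rewrite e0 e1 -/k => /(_ isT); nra.
Qed.

End spread.

Section vysochanskij_petunin.
Context d (T : measurableType d) (R : realType) (P : probability T R).
Implicit Types X : {RV P >-> R}.

(** For [M < 1] the bound is [1 / 6 + lam (rho2 - 3 / 8)] with [lam] between
    [4 / 9] and [4 / 3]; at these two slopes it is one of the two terms of the
    maximum. *)
Lemma spread_tail_max X M (rho2 r : R) : spread_from X M -> 0 <= M ->
  (\int[P]_w ((X w) ^+ 2)%:E = rho2%:E)%E -> 1 < r ->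
  (P [set w | (r <= `|X w|)%R] <=
   (Num.max (4 / 9 * rho2) ((4 * rho2 - 1) / 3))%:E)%E.
Proof.
move=> sX M0 X2 r1; have [M1|M1] := ltP M 1.
  pose lam := 4 / (9 - 6 * M ^+ 2).
  have d0 : 0 < 9 - 6 * M ^+ 2 by nra.
  have lamE : lam * (9 - 6 * M ^+ 2) = 4 by rewrite /lam divfK// gt_eqF.
  have l0 : 0 <= lam by rewrite divr_ge0// ltW.
  have avg0 x : 0 <= average lam (- lam * M ^+ 2 / 4) M x.
    by apply: average_ge0_inner; rewrite M0.
  apply: (le_trans (spread_tail_bound sX M0 l0 avg0 X2 r1)).
  have l1 : 4 / 9 <= lam by have := mulr_ge0 l0 (sqr_ge0 M); lra.
  have l2 : lam <= 4 / 3.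
    have : 0 <= 1 - M ^+ 2 by nra.
    by move/(mulr_ge0 l0); lra.
  have -> : lam * rho2 + - lam * M ^+ 2 / 4 = 1 / 6 + lam * (rho2 - 3 / 8).
    by have -> : - lam * M ^+ 2 = (lam * (9 - 6 * M ^+ 2) - 9 * lam) / 6;
      [field|rewrite lamE; field].
  by rewrite lee_fin le_max; apply/orP; have [h|h] := leP (3 / 8) rho2;
    [right|left]; nra.
have l0 : 0 <= 4 / 3 :> R by lra.
apply: (le_trans (spread_tail_bound sX M0 l0 _ X2 r1)).
  by move=> x; exact: average_ge0_outer.
by rewrite lee_fin le_max; apply/orP; right; lra.
Qed.

(** The bound is continuous in [k]; [s = 1 - k] below is small enough, relative
    to the gap [m] between [p] and the bound at [1], to keep a strict excess. *)
Lemma dominated_at_limit (p B : R) : 0 <= p -> 0 <= B ->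
  (forall k, 0 < k < 1 ->
    p <= Num.max (4 / 9 * (B / k ^+ 2)) ((4 * (B / k ^+ 2) - 1) / 3)) ->
  p <= Num.max (4 / 9 * B) ((4 * B - 1) / 3).
Proof.
move=> p0 B0 h; rewrite leNgt gt_max; apply/negP => /andP[h1 h2].
pose a := p - 4 / 9 * B; pose b := 3 * p + 1 - 4 * B.
pose m := Num.min (Num.min a b) 1.
have m0 : 0 < m by rewrite !lt_min ltr01 /a /b andbT; apply/andP; split; lra.
have ma : m <= a by rewrite !ge_min lexx.
have mb : m <= b by rewrite !ge_min lexx orbT.
have m1 : m <= 1 by rewrite ge_min lexx orbT.
pose s := m / (8 * (p + 1)).
have sE : s * (8 * (p + 1)) = m by rewrite divfK//; lra.
have s0 : 0 < s by rewrite divr_gt0//; lra.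
have sp : 0 <= s * p by rewrite mulr_ge0// ltW.
pose k := 1 - s.
have k0 : 0 < k by rewrite /k; lra.
have k1 : k < 1 by rewrite /k; lra.
have k2 : k ^+ 2 * (B / k ^+ 2) = B by rewrite mulrC divfK// expf_neq0// gt_eqF.
have kk : 0 < k ^+ 2 by rewrite exprn_gt0.
have := h k; rewrite k0 k1 => /(_ isT); rewrite le_max => /orP[] H.
  have := ler_wpM2l (ltW kk) H; rewrite mulrCA k2.
  rewrite /k /a in ma *; have := sqr_ge0 s; nra.
have {}H : 3 * p + 1 <= 4 * (B / k ^+ 2) by lra.
have := ler_wpM2l (ltW kk) H; rewrite [_ ^+ 2 * (4 * _)]mulrCA k2.
rewrite /k /b in mb *; have := sqr_ge0 s; nra.
Qed.

(** A reflection about [al] gives [al <= M], and dividing by [k * r] with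
    [k < 1] makes the threshold [k^-1 > 1]; then [k] tends to [1]. *)
Lemma vysochanskij_petunin X M (al rho2 r : R) : spread_from X M ->
  (\int[P]_w ((X w - al) ^+ 2)%:E = rho2%:E)%E -> 0 < r ->
  (P [set w | (r <= `|X w - al|)%R] <=
   (Num.max (4 / 9 * (rho2 / r ^+ 2)) ((4 * (rho2 / r ^+ 2) - 1) / 3))%:E)%E.
Proof.
move=> sX X2 r0; set S := [set w | _].
have mS : measurable S.
  have := @measurable_abs_ge _ _ _ P (affine 1 (- al) X) r.
  by congr measurable; apply/seteqP; split=> w; rewrite /S/= /affine mul1r.
have rho0 : 0 <= rho2.
  by rewrite -lee_fin -X2; apply: integral_ge0 => w _; rewrite lee_fin sqr_ge0.
have PS : (P S = (fine (P S))%:E) by rewrite fineK// fin_num_measure.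
rewrite PS lee_fin; apply: dominated_at_limit.
- exact: fine_ge0.
- by rewrite divr_ge0// exprn_ge0// ltW.
move=> k /andP[k0 k1].
pose sg : R := if al <= M then 1 else -1.
have sg2 : sg ^+ 2 = 1 by rewrite /sg; case: ifP; rewrite ?sqrrN expr1n.
have sgM : 0 <= sg * (M - al).
  by rewrite /sg; case: (leP al M); lra.
have kr : 0 < k * r by exact: mulr_gt0.
pose Z : {RV P >-> R} := affine (sg / (k * r)) (- (sg / (k * r)) * al) X.
have ZE w : Z w = sg * (X w - al) / (k * r).
  by rewrite /Z/=/affine; field; rewrite !gt_eqF.
have sZ : spread_from Z (sg * (M - al) / (k * r)).
  have := @spread_affine _ _ _ _ X M (sg / (k * r)) (- (sg / (k * r)) * al) sX.
  by congr (spread_from _ _); field; rewrite !gt_eqF.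
have M0 : 0 <= sg * (M - al) / (k * r) by rewrite divr_ge0// ltW.
have Z2 : (\int[P]_w ((Z w) ^+ 2)%:E = (rho2 / r ^+ 2 / k ^+ 2)%:E)%E.
  have mX2 : measurable_fun setT (fun w => ((X w - al) ^+ 2)%:E).
    by apply/measurable_EFinP/measurable_funX; exact: measurable_funB.
  have -> : rho2 / r ^+ 2 / k ^+ 2 = ((k * r) ^- 2) * rho2.
    by field; rewrite !gt_eqF.
  rewrite EFinM -X2 -ge0_integralZl//; last 2 first.
  - by move=> w _; rewrite lee_fin sqr_ge0.
  - by rewrite lee_fin invr_ge0 exprn_ge0// ltW.
  apply: eq_integral => w _; rewrite -EFinM ZE !exprMn sg2 mul1r exprVn.
  by rewrite mulrC exprMn.
have k1' : 1 < k^-1 by rewrite invf_gt1.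
have := spread_tail_max sZ M0 Z2 k1'.
have -> : [set w | (k^-1 <= `|Z w|)%R] = S.
  have sg1 : `|sg| = 1 by rewrite /sg; case: ifP; rewrite ?normrN normr1.
  apply/seteqP; split=> w; rewrite /S/= ZE !normrM sg1 mul1r normfV
    (gtr0_norm kr) ler_pdivlMr// mulrA mulVf ?mul1r ?gt_eqF//.
by rewrite PS lee_fin.
Qed.

End vysochanskij_petunin.

(** * Moments *)

Section moments.
Context d (T : measurableType d) (R : realType) (P : probability T R).
Implicit Types X : {RV P >-> R}.

Lemma variance_centered X : ('E_P[X] = 0)%E ->
  ('V_P[X] = \int[P]_w ((X w) ^+ 2)%:E)%E.
Proof.
move=> X0; rewrite /variance unlock X0/= unlock.
apply: eq_integral => w _; congr EFin; rewrite expr2 -[X w]subr0; exact: erefl.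
Qed.

(** A finite second moment gives integrability by [|x| <= x^2 + 1], so the
    square can be expanded under the integral. *)
Lemma second_moment_shift X (s : R) :
  (\int[P]_w ((X w) ^+ 2)%:E = s%:E)%E ->
  exists m, ('E_P[X] = m%:E)%E /\
    forall a, (\int[P]_w ((X w - a) ^+ 2)%:E = (s - 2 * a * m + a ^+ 2)%:E)%E.
Proof.
move=> X2.
have mX2 : measurable_fun setT (fun w => ((X w) ^+ 2)%:E).
  exact/measurable_EFinP/measurable_funX.
have iX2 : P.-integrable setT (fun w => ((X w) ^+ 2)%:E).
  apply/integrableP; split=> //.
  under eq_integral do rewrite gee0_abs ?lee_fin ?sqr_ge0//.
  by rewrite X2 ltry.
have ic (c : R) : P.-integrable setT (fun=> c%:E).
  exact: finite_measure_integrable_cst.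
have iX : P.-integrable setT (EFin \o X).
  apply: (@le_integrable _ _ _ P _ measurableT _
      (fun w => ((X w) ^+ 2)%:E + 1%:E)%E).
  - exact/measurable_EFinP.
  - move=> w _; rewrite /= lee_fin [leRHS]ger0_norm; last first.
      by rewrite addr_ge0 ?sqr_ge0.
    have := sqr_ge0 (`|X w| - 1); have := sqr_ge0 (`|X w|).
    by rewrite -(@real_normK _ (X w)) ?num_real//; lra.
  - exact: integrableD.
have Efin : ('E_P[X])%E \is a fin_num.
  by rewrite unlock; exact: integrable_fin_num.
exists (fine 'E_P[X]); split; first by rewrite fineK.
move=> a.
transitivity (\int[P]_w (((X w) ^+ 2)%:E +
    ((- (2 * a))%:E * (X w)%:E + (a ^+ 2)%:E)))%E.
  by apply: eq_integral => w _; rewrite -EFinM -!EFinD; congr EFin; ring.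
rewrite integralD//; last first.
  by apply: integrableD => //; exact: integrableZl.
rewrite integralD//; last exact: integrableZl.
rewrite X2 integralZl//.
have -> : (\int[P]__ (a ^+ 2)%:E = (a ^+ 2)%:E)%E.
  by rewrite integral_cst//= probability_setT mule1.
have -> : (\int[P]_w (X w)%:E = (fine 'E_P[X])%:E)%E by rewrite fineK// unlock.
by rewrite -EFinM -!EFinD; congr EFin; ring.
Qed.

(** Expanding the square gives [1 - 2 a E X + a^2] for the second moment about
    [a]; comparison at [a = 1] gives [E X = 0]. *)
Lemma mean_variance_shift X :
  (forall a, (\int[P]_w ((X w - a) ^+ 2)%:E = (1 + a ^+ 2)%:E)%E) ->
  ('E_P[X] = 0)%E /\ ('V_P[X] = 1)%E.
Proof.
move=> h; have X2 : (\int[P]_w ((X w) ^+ 2)%:E = 1%:E)%E.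
  have := h 0; rewrite expr0n addr0 => <-.
  by apply: eq_integral => w _; rewrite subr0.
have [m [Xm Xa]] := second_moment_shift X2.
have X0 : ('E_P[X] = 0)%E.
  rewrite Xm; congr EFin.
  by have := Xa 1; rewrite h => -[]; lra.
by rewrite variance_centered// X2.
Qed.

End moments.

(** * Mixtures of uniform laws *)

Section mixture.
Context d (T : measurableType d) (R : realType) (P : probability T R).

(** The union of the [E i] has a null complement. *)
Lemma probability_partition n (E : 'I_n -> set T) B :
  (forall i, measurable (E i)) -> trivIset setT E ->
  (\sum_(i < n) P (E i) = 1)%E -> measurable B ->
  (P B = \sum_(i < n) P (B `&` E i))%E.
Proof.
move=> mE tE E1 mB; pose S := \big[setU/set0]_(i < n) E i.
have mS : measurable S by exact: bigsetU_measurable.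
have PS : (P S = 1)%E by rewrite measure_bigsetU_ord.
have PCS : (P (~` S) = 0)%E by rewrite probability_setC// PS subee.
rewrite -measure_bigsetU_ord; last 2 first.
- by move=> i; exact: measurableI.
- apply/trivIsetP => i j _ _ ij.
  by rewrite setIACA setIid (trivIsetP.1 tE)// setI0.
have -> : \big[setU/set0]_(i < n) (B `&` E i) = B `&` S.
  by rewrite /S big_distrr.
rewrite (measureDI P mB mS) setDE (@subset_measure0 _ _ _ _ _ (~` S)) ?add0e//.
- by apply: measurableI => //; exact: measurableC.
- exact: measurableC.
Qed.

Variables (n : nat) (y p : nat -> R) (m : R).
Hypotheses (p0 : forall i, 0 <= p i) (p1 : \sum_(i < n) p i = 1).
Hypothesis y_inj : {in gtn n &, injective y}.
Variables U Y Z : {RV P >-> R}.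
Hypotheses (UY : independent_RVs U Y) (U01 : uniform01 U).
Hypothesis Yp : forall i, (i < n)%N -> P [set w | Y w = y i] = (p i)%:E.
Hypothesis ZE : forall w, Z w = m + U w * Y w.

(* The uniform law lives on [measurableTypeR R], a copy of [R] with another
   display. *)
Let idTR : measurableTypeR R -> R := idfun.

#[local] HB.instance Definition _ :=
  @isMeasurableFun.Build _ _ _ _ idTR (@measurable_id _ _ setT).

Let law i := distribution (uniform_prob (@ltr01 R)) (affine (y i) m idTR).

(** On the event [Y = y i], [Z] is the function [m + U * y i] of [U], which is
    independent of that event. *)
Lemma distribution_mixture A : measurable A ->
  (distribution P Z A = \sum_(i < n) (p i)%:E * law i A)%E.
Proof.
move=> mA.
pose E (i : 'I_n) := Y @^-1` [set y i].
have mE i : measurable (E i) by exact: measurable_funPTI.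
rewrite /distribution /pushforward (@probability_partition n E)//; last 3 first.
- apply/trivIsetP => i j _ _ ij; rewrite -subset0 => w [Ewi Ewj].
  have yij : y i = y j by rewrite -Ewi -Ewj.
  by move/eqP: ij; apply; apply/val_inj/y_inj; rewrite // inE/=.
- rewrite -[RHS]/(1%:E) -p1 -sumEFin; apply: eq_bigr => i _; exact: Yp.
- exact: measurable_funPTI.
apply: eq_bigr => i _.
pose B := affine (y i) m idTR @^-1` A.
have mB : measurable B by exact: measurable_funPTI.
have -> : Z @^-1` A `&` E i = U @^-1` B `&` E i.
  apply/seteqP; split=> w [/= Aw Ew]; split=> //; move: Aw;
    by rewrite /B/= ZE /affine/= Ew mulrC addrC.
rewrite UY// muleC; congr (_ * _)%E; first exact: Yp.
exact: U01.
Qed.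

Lemma probability_mixture A : measurable A ->
  (P (Z @^-1` A) = \sum_(i < n) (p i)%:E *
    uniform_prob (@ltr01 R) ((fun x => (m + x * y i)%R) @^-1` A))%E.
Proof.
move=> mA; rewrite -[LHS]/(distribution P Z A) distribution_mixture//.
apply: eq_bigr => i _; congr (_ * uniform_prob _ _)%E.
by apply/seteqP; split=> x; rewrite /= /affine mulrC addrC.
Qed.

Lemma integral_mixture (f : R -> R) :
  measurable_fun setT f -> (forall x, 0 <= f x) ->
  (\int[P]_w (f (Z w))%:E =
   \sum_(i < n) (p i)%:E *
     \int[lebesgue_measure]_(x in `[0%R, 1%R]) (f (m + x * y i))%:E)%E.
Proof.
move=> mf f0.
have mf' : measurable_fun setT (EFin \o f) by exact/measurable_EFinP.
have f0' x : (0 <= (f x)%:E)%E by rewrite lee_fin.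
pose mu i := mscale (NngNum (p0 i)) (law i).
transitivity (\int[distribution P Z]_x (f x)%:E)%E.
  by rewrite (ge0_integral_distribution _ mf').
transitivity (\int[msum mu n]_x (f x)%:E)%E.
  by apply: eq_measure_integral => A mA _; exact: distribution_mixture.
rewrite ge0_integral_measure_sum//; apply: eq_bigr => i _.
rewrite ge0_integral_mscale//; congr (_ * _)%E.
rewrite (ge0_integral_distribution _ mf')//.
rewrite integral_uniform; last 2 first.
- by apply: (measurableT_comp mf'); exact: measurable_affine.
- by move=> x; exact: f0'.
rewrite subr0 invr1 mul1e; apply: eq_integral => x _.
by rewrite /= /affine addrC mulrC.
Qed.

End mixture.

Section uniform01.
Context {R : realType}.

Lemma uniform_prob01E (A : set R) : measurable A ->
  uniform_prob (@ltr01 R) A = lebesgue_measure (A `&` `[0, 1]).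
Proof.
move=> mA; rewrite /uniform_prob integral_uniform_pdf.
rewrite (eq_integral (cst 1%E)).
  by rewrite integral_cst ?mul1e//; exact: measurableI.
move=> x; rewrite inE => -[_]; rewrite /= in_itv/= /uniform_pdf => ->.
by rewrite subr0 invr1.
Qed.

Lemma uniform_prob01_itv (A : set R) (a b : R) : measurable A -> a <= b ->
  A `&` `[0, 1] = `[a, b]%classic -> uniform_prob (@ltr01 R) A = (b - a)%:E.
Proof.
move=> mA ab AE; rewrite uniform_prob01E// AE lebesgue_measure_itv/= lte_fin.
move: ab; rewrite le_eqVlt => /orP[/eqP->|->//].
by rewrite ltxx subrr.
Qed.

Lemma uniform_prob01_null (A : set R) : measurable A ->
  A `&` `[0, 1] `<=` set0 -> uniform_prob (@ltr01 R) A = 0%E.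
Proof.
by move=> mA; rewrite subset0 uniform_prob01E// => ->; rewrite measure0.
Qed.

Lemma uniform_prob01_one (A : set R) : measurable A ->
  `[0, 1] `<=` A -> uniform_prob (@ltr01 R) A = 1%E.
Proof.
move=> mA /setIidr AE; rewrite (uniform_prob01_itv mA ler01 AE).
by rewrite subr0.
Qed.

Lemma integral_affine_sq (k y : R) :
  (\int[lebesgue_measure]_(x in `[0%R, 1%R]) ((k + x * y) ^+ 2)%:E =
   (k ^+ 2 + k * y + y ^+ 2 / 3)%:E)%E.
Proof.
pose f x := (k + x * y) ^+ 2.
(* A primitive of [f]; the cube of [k + x * y] over [3 * y] would exclude
   [y = 0]. *)
pose q : {poly R} :=
  (k ^+ 2)%:P * 'X + (k * y)%:P * 'X^2 + (y ^+ 2 / 3)%:P * 'X^3.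
have cq : continuous (horner q) by exact: continuous_horner.
have cf : continuous f.
  have -> : f = horner ((k%:P + 'X * y%:P) ^+ 2).
    by apply/funext => x; rewrite /f !hornerE.
  exact: continuous_horner.
rewrite (@continuous_FTC2 _ f (horner q))//.
- by rewrite /q !hornerE/= -EFinB; congr EFin; field.
- by apply: continuous_subspaceT => x; exact: cf.
- split.
  + by move=> x _; exact: derivable_horner.
  + by apply: cvg_at_right_filter; exact: cq.
  + by apply: cvg_at_left_filter; exact: cq.
- by move=> x _; rewrite -derivE /q !poly.derivE !hornerE/= /f; field.
Qed.

End uniform01.

Lemma convex_function_max0 (R : realType) (D : set R) (f : R -> R) :
  @convex_function R R^o D f ->
  @convex_function R R^o D (fun x => Num.max 0 (f x)).
Proof.
move=> /convex_functionP cf; apply/convex_functionP => t x z t01 Dx Dz.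
have /andP[t0 t1] := t01.
have m0 (b : R) : 0 <= Num.max 0 b by rewrite le_max lexx.
have mf (b : R) : b <= Num.max 0 b by rewrite le_max lexx orbT.
have t1' : 0 <= 1 - t by lra.
rewrite ge_max addr_ge0 ?mulr_ge0//=.
by rewrite (le_trans (cf _ _ _ t01 Dx Dz))// lerD// ler_wpM2l.
Qed.

Lemma convex_function_affine (R : realType) (D : set R) (k l : R) :
  @convex_function R R^o D (fun x => k * x + l).
Proof.
apply/convex_functionP => t x z _ _ _.
by rewrite le_eqVlt; apply/orP; left; apply/eqP; ring.
Qed.

Lemma convex_function_scale (R : realType) (D : set R) (k l : R) (f : R -> R) :
  0 <= k -> @convex_function R R^o D f ->
  @convex_function R R^o D (fun x => k * f x + l).
Proof.
move=> k0 /convex_functionP cf; apply/convex_functionP => t x z t01 Dx Dz.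
by have := ler_wpM2l k0 (cf _ _ _ t01 Dx Dz); lra.
Qed.

Lemma eq_convex_function (R : realType) (D : set R) (f g : R -> R) :
  {in D, f =1 g} ->
  (forall x z t, 0 <= t <= 1 -> D x -> D z -> D (t * x + (1 - t) * z)) ->
  @convex_function R R^o D f -> @convex_function R R^o D g.
Proof.
move=> fg cD /convex_functionP cf; apply/convex_functionP => t x z t01 Dx Dz.
by rewrite -!fg ?inE//; [exact: cf|exact: cD].
Qed.

Section three_point_mixture.
Context d (T : measurableType d) (R : realType) (P : probability T R).
Variables (m a pm p0 pp : R) (U Y Z : {RV P >-> R}).
Hypotheses (a0 : 0 < a) (pm0 : 0 <= pm) (p00 : 0 <= p0) (pp0 : 0 <= pp).
Hypothesis p1 : pm + p0 + pp = 1.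
Hypotheses (UY : independent_RVs U Y) (U01 : uniform01 U).
Hypothesis Ym : P [set w | Y w = - a] = pm%:E.
Hypothesis Y0 : P [set w | Y w = 0] = p0%:E.
Hypothesis Yp : P [set w | Y w = a] = pp%:E.
Hypothesis ZE : forall w, Z w = m + U w * Y w.

Let y := nth 0 [:: - a; 0; a].
Let p := nth 0 [:: pm; p0; pp].

Let p_ge0 i : 0 <= p i. Proof. by case: i => [|[|[|[]]]]. Qed.

Let p_sum : \sum_(i < 3) p i = 1.
Proof. by rewrite !big_ord_recr big_ord0/= add0r. Qed.

Let y_inj : {in gtn 3 &, injective y}.
Proof.
have a1 : (- a == a) = false by apply/negbTE/eqP => e; have := a0; lra.
have a2 : (a == 0) = false by rewrite gt_eqF.
by move=> [|[|[|i]]] [|[|[|j]]]; rewrite !inE //= => _ _ /eqP;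
  rewrite ?oppr_eq0 ?[0 == _]eq_sym ?oppr_eq0 ?[a == - a]eq_sym ?a1 ?a2.
Qed.

Let Y_prob i : (i < 3)%N -> P [set w | Y w = y i] = (p i)%:E.
Proof. by case: i => [|[|[|]]]. Qed.

Local Notation unif := (uniform_prob (@ltr01 R)).

Let pos A q := unif ((fun x => m + x * q) @^-1` A).

Lemma three_point_probability A : measurable A ->
  (P (Z @^-1` A) = pm%:E * pos A (- a) + p0%:E * pos A 0 + pp%:E * pos A a)%E.
Proof.
move=> mA; rewrite (probability_mixture p_sum y_inj UY U01 Y_prob ZE mA).
by rewrite !big_ord_recr big_ord0/= add0e.
Qed.

Lemma three_point_second_moment c :
  (\int[P]_w ((Z w - c) ^+ 2)%:E =
   ((m - c) ^+ 2 + (m - c) * (a * (pp - pm)) + a ^+ 2 * (pp + pm) / 3)%:E)%E.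
Proof.
have mf : measurable_fun setT (fun z : R => (z - c) ^+ 2).
  by apply: measurable_funX; exact: measurable_funB.
rewrite (integral_mixture p_ge0 p_sum y_inj UY U01 Y_prob ZE mf); last first.
  by move=> z; exact: sqr_ge0.
have int q :
    (\int[lebesgue_measure]_(x in `[0%R, 1%R]) ((m + x * q - c) ^+ 2)%:E =
    ((m - c) ^+ 2 + (m - c) * q + q ^+ 2 / 3)%:E)%E.
  by rewrite -integral_affine_sq; apply: eq_integral => x _; rewrite addrAC.
rewrite !big_ord_recr big_ord0/= add0e !int -!EFinM -!EFinD /p /y/=; congr EFin.
have -> : p0 = 1 - pm - pp by rewrite -p1; ring.
by field.
Qed.

Let measurable_line A q : measurable A ->
  measurable ((fun x : R => m + x * q) @^-1` A).
Proof.
move=> mA; have mq : measurable_fun setT (fun x : R => m + x * q).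
  by apply: measurable_funD => //; exact: measurable_funM.
by rewrite -[X in measurable X]setTI; exact: mq.
Qed.

(** For [q = a] or [q = - a], the point [m + x * q] with [0 <= x <= 1] is at
    distance [x * a] from [m], so it is in the tail for [k / a <= x]. *)
Lemma three_point_tail k : 0 < k <= a ->
  P [set w | Z w <= m - k \/ m + k <= Z w] = ((pm + pp) * (1 - k / a))%:E.
Proof.
move=> /andP[k0 ka]; pose A : set R := [set z | z <= m - k \/ m + k <= z].
have mA : measurable A.
  have -> : A = `]-oo, m - k] `|` `[m + k, +oo[.
    by apply/seteqP; split=> z; rewrite /A/= !in_itv/= andbT.
  exact: measurableU.
have ka1 : k / a <= 1 by rewrite ler_pdivrMr ?mul1r.
have ka0 : 0 < k / a by exact: divr_gt0.
have outer q : `|q| = a -> pos A q = (1 - k / a)%:E.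
  move=> qa; apply: uniform_prob01_itv => //; first exact: measurable_line.
  apply/seteqP; split=> x; rewrite /A/= !in_itv/=.
    move=> [h /andP[x0 x1]]; rewrite x1 andbT ler_pdivrMr//.
    have : x * q <= x * a by rewrite ler_wpM2l// -qa ler_norm.
    have : x * - q <= x * a by rewrite ler_wpM2l// -qa -normrN ler_norm.
    by case: h => h; lra.
  move=> /andP[kx x1]; have x0 : 0 <= x by lra.
  rewrite x0 x1; split=> //; move: kx; rewrite ler_pdivrMr// => kx.
  move: qa; case: (ger0P q) => _ qa; [right|left]; first by rewrite qa; lra.
  have -> : q = - a by lra.
  by lra.
have mid : pos A 0 = 0%E.
  apply: uniform_prob01_null; first exact: measurable_line.
  by move=> x [/=]; rewrite /A/= mulr0 addr0 => -[] h; lra.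
rewrite -[LHS]/(P (Z @^-1` A)) three_point_probability// mid !outer.
- by rewrite mule0 adde0 -!EFinM -EFinD mulrDl.
- by rewrite gtr0_norm.
- by rewrite normrN gtr0_norm.
Qed.

Lemma three_point_cdf_left z : z < m ->
  distribution_function Z z = pm * Num.max 0 (1 + (z - m) / a).
Proof.
move=> zm; rewrite /distribution_function /cdf/=.
rewrite -[distribution _ _ _]/(P (Z @^-1` _)).
rewrite three_point_probability//.
have -> : pos `]-oo, z] (- a) = (Num.max 0 (1 + (z - m) / a))%:E.
  have [h|h] := leP 0 (1 + (z - m) / a).
    have -> : 1 + (z - m) / a = 1 - (m - z) / a.
      by rewrite -[m - z]opprB mulNr opprK.
    apply: uniform_prob01_itv; first exact: measurable_line.
      by rewrite -[m - z]opprB mulNr; lra.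
    apply/seteqP; split=> x; rewrite /= !in_itv/=.
      by move=> [h1 /andP[x0 x1]]; rewrite x1 andbT ler_pdivrMr//; lra.
    rewrite ler_pdivrMr// => /andP[h1 x1]; rewrite x1 andbT; split; first lra.
    by rewrite -(pmulr_lge0 _ a0); lra.
  apply: uniform_prob01_null; first exact: measurable_line.
  move=> x [/=]; rewrite !in_itv/= => h1 /andP[x0 x1].
  have : 1 * a + (z - m) < 0.
    have -> : 1 * a + (z - m) = (1 + (z - m) / a) * a by field; rewrite gt_eqF.
    by rewrite nmulr_rlt0.
  have : x * a <= 1 * a by rewrite ler_wpM2r// ltW.
  by lra.
have -> : pos `]-oo, z] 0 = 0%E.
  apply: uniform_prob01_null; first exact: measurable_line.
  by move=> x [/=]; rewrite in_itv/= mulr0 addr0; lra.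
have -> : pos `]-oo, z] a = 0%E.
  apply: uniform_prob01_null; first exact: measurable_line.
  move=> x [/=]; rewrite !in_itv/= => h /andP[x0 _].
  by have := mulr_ge0 x0 (ltW a0); lra.
by rewrite !mule0 !adde0.
Qed.

Lemma three_point_cdf_right z : m <= z ->
  distribution_function Z z = pm + p0 + pp * Num.min 1 ((z - m) / a).
Proof.
move=> mz; rewrite /distribution_function /cdf/=.
rewrite -[distribution _ _ _]/(P (Z @^-1` _)).
rewrite three_point_probability//.
have -> : pos `]-oo, z] (- a) = 1%E.
  apply: uniform_prob01_one; first exact: measurable_line.
  move=> x /=; rewrite !in_itv/= => /andP[x0 _].
  by have := mulr_ge0 x0 (ltW a0); lra.
have -> : pos `]-oo, z] 0 = 1%E.
  apply: uniform_prob01_one; first exact: measurable_line.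
  by move=> x /= _; rewrite in_itv/= mulr0 addr0.
have -> : pos `]-oo, z] a = (Num.min 1 ((z - m) / a))%:E.
  have [h|h] := leP 1 ((z - m) / a).
    apply: uniform_prob01_one; first exact: measurable_line.
    move=> x /=; rewrite !in_itv/= => /andP[x0 x1].
    have : x * a <= z - m.
      by rewrite -ler_pdivlMr// (le_trans x1).
    by lra.
  have za : 0 <= (z - m) / a by rewrite divr_ge0 ?subr_ge0// ltW.
  rewrite -[X in X%:E]subr0; apply: uniform_prob01_itv => //.
    exact: measurable_line.
  apply/seteqP; split=> x; rewrite /= !in_itv/=.
    by move=> [h1 /andP[x0 x1]]; rewrite x0/= ler_pdivlMr//; lra.
  move=> /andP[x0 x1]; rewrite x0/= (le_trans x1 (ltW h)); split=> //.
  by move: x1; rewrite ler_pdivlMr//; lra.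
by rewrite !mule1 -EFinM -!EFinD.
Qed.

Lemma three_point_unimodal : unimodal Z.
Proof.
exists m; split.
- apply: (@eq_convex_function _ _
      (fun z => pm * Num.max 0 (a^-1 * z + (1 - m / a)) + 0)).
  + move=> z; rewrite inE/= in_itv/= => zm; rewrite three_point_cdf_left//.
    by rewrite addr0; congr (_ * Num.max 0 _); field; rewrite gt_eqF.
  + move=> x z t /andP[t0 t1] /=; rewrite !in_itv/= => xm zm.
    have xk : x <= Num.max x z by rewrite le_max lexx.
    have zk : z <= Num.max x z by rewrite le_max lexx orbT.
    have : Num.max x z < m by rewrite gt_max xm.
    by nra.
  + by apply/convex_function_scale/convex_function_max0/convex_function_affine.
- apply: (@eq_convex_function _ _
      (fun z => pp * Num.max 0 (- a^-1 * z + (1 + m / a)) + - 1)).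
  + move=> z; rewrite inE/= in_itv/= andbT => zm.
    rewrite three_point_cdf_right//.
    have -> : Num.min 1 ((z - m) / a) = 1 - Num.max 0 (1 - (z - m) / a).
      by case: (leP 1 ((z - m) / a)) => h; [rewrite max_l|rewrite max_r]; lra.
    have -> : 1 - (z - m) / a = - a^-1 * z + (1 + m / a).
      by field; rewrite gt_eqF.
    have -> : p0 = 1 - pm - pp by rewrite -p1; ring.
    by ring.
  + move=> x z t /andP[t0 t1] /=; rewrite !in_itv/= !andbT; nra.
  + by apply/convex_function_scale/convex_function_max0/convex_function_affine.
Qed.

End three_point_mixture.

(** * The sharp inequality *)

Section interval_condition.
Context {R : realType}.

(** The lower bound on [u] is the smaller root of a concave quadratic, which is
    still nonnegative at the upper bound [v + 2 / v] because [v^2 >= 5/3]; so it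
    is nonnegative in between. *)
Lemma interval_condition (u v : R) : Num.sqrt (5 / 3) <= v ->
  Num.max v ((11 * v - 4 * Num.sqrt (6 * v ^+ 2 - 10)) / 5) <= u ->
  u <= v + 2 / v ->
  [/\ 0 < v, v <= u & 8 * (4 + (u - v) ^+ 2) <= 3 * (u + v) ^+ 2].
Proof.
move=> hv; rewrite ge_max => /andP[vu uL] hu.
have v0 : 0 < v by apply: lt_le_trans hv; rewrite sqrtr_gt0; lra.
have v2 : 5 / 3 <= v ^+ 2.
  rewrite -(@sqr_sqrtr _ (5 / 3)); last lra.
  by rewrite ler_sqr// nnegrE ?sqrtr_ge0// ltW.
split=> //.
set s := Num.sqrt _ in uL; have s0 : 0 <= s by exact: sqrtr_ge0.
have s2 : s ^+ 2 = 6 * v ^+ 2 - 10 by rewrite sqr_sqrtr//; lra.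
have vw : v * (v + 2 / v) = v ^+ 2 + 2 by field; rewrite gt_eqF.
set w := v + 2 / v in hu vw.
(* The gap between the two sides is the quadratic
   [-5 (z - (11 v - 4 s) / 5) (z - (11 v + 4 s) / 5)] at [z = u]. *)
have quad z : 3 * (z + v) ^+ 2 - 8 * (4 + (z - v) ^+ 2) =
    5 * (z - (11 * v - 4 * s) / 5) * ((11 * v + 4 * s) / 5 - z).
  have -> : 5 * (z - (11 * v - 4 * s) / 5) * ((11 * v + 4 * s) / 5 - z) =
    (16 * s ^+ 2 - (5 * z - 11 * v) ^+ 2) / 5 by field.
  by rewrite s2; field.
have qw : 0 <= 3 * (w + v) ^+ 2 - 8 * (4 + (w - v) ^+ 2).
  have e : v ^+ 2 * (3 * (w + v) ^+ 2 - 8 * (4 + (w - v) ^+ 2)) =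
      4 * (3 * v ^+ 2 - 5) * (v ^+ 2 + 1).
    have -> : v ^+ 2 * (3 * (w + v) ^+ 2 - 8 * (4 + (w - v) ^+ 2)) =
        3 * (v * w + v ^+ 2) ^+ 2 - 8 * (4 * v ^+ 2 + (v * w - v ^+ 2) ^+ 2).
      by ring.
    by rewrite vw; ring.
  rewrite -(pmulr_rge0 _ (exprn_gt0 2 v0)) e !mulr_ge0//; lra.
rewrite -subr_ge0 quad mulr_ge0 ?mulr_ge0 ?subr_ge0//.
rewrite leNgt; apply/negP => uU.
move: qw; rewrite quad leNgt => /negP; apply.
by rewrite pmulr_rlt0 ?mulr_gt0 ?subr_gt0 ?subr_lt0//; lra.
Qed.

End interval_condition.

Theorem theorem5p3 (R : realType) (d : measure_display) (T : measurableType d)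
    (P : probability T R) (u v : R)
    (hv : Num.sqrt (5 / 3) <= v)
    (hu1 : Num.max v ((11 * v - 4 * Num.sqrt (6 * v ^+ 2 - 10)) / 5) <= u)
    (hu2 : u <= v + 2 / v) :
  let bound : R := 4 / 9 * ((4 + (u - v) ^+ 2) / (u + v) ^+ 2) in
  let pm : R := 4 / 3 * ((2 + v * (v - u)) / (u + v) ^+ 2) in
  let p0 : R := 1 - 4 / 3 * ((4 + (v - u) ^+ 2) / (u + v) ^+ 2) in
  let pp : R := 4 / 3 * ((2 + u * (u - v)) / (u + v) ^+ 2) in
  (forall Z : {RV P >-> R},
      unimodal Z -> ('E_P[Z] = 0)%E -> ('V_P[Z] = 1)%E ->
      (P [set w | (Z w <= - u)%R \/ (v <= Z w)%R] <= bound%:E)%E)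
  /\ [/\ 0 <= pm, 0 <= p0 & 0 <= pp]
  /\ (forall U Y Z : {RV P >-> R},
      independent_RVs U Y ->
      uniform01 U ->
      P [set w | Y w = - (3 / 4 * (u + v))] = pm%:E ->
      P [set w | Y w = 0] = p0%:E ->
      P [set w | Y w = 3 / 4 * (u + v)] = pp%:E ->
      (forall w, Z w = (v - u) / 2 + U w * Y w) ->
      [/\ unimodal Z, ('E_P[Z] = 0)%E, ('V_P[Z] = 1)%E &
          P [set w | Z w <= - u \/ v <= Z w] = bound%:E]).
Proof.
move=> bound pm p0 pp.
have [v0 vu gap] := interval_condition hv hu1 hu2.
have s0 : 0 < u + v by lra.
have s20 : 0 < (u + v) ^+ 2 by exact: exprn_gt0.
have sn0 : u + v != 0 by rewrite gt_eqF.
have vuv : v * (u - v) <= 2.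
  have -> : 2 = v * (2 / v) by field; rewrite gt_eqF.
  by rewrite ler_pM2l//; lra.
have uuv : 0 <= u * (u - v) by rewrite mulr_ge0//; lra.
set m := (v - u) / 2; set r := (u + v) / 2; set a := 3 / 4 * (u + v).
have r0 : 0 < r by rewrite /r; lra.
have nonneg : [/\ 0 <= pm, 0 <= p0 & 0 <= pp].
  split.
  - by rewrite mulr_ge0// divr_ge0 ?(ltW s20)//; lra.
  - rewrite subr_ge0 mulrA ler_pdivrMr// mul1r.
    have : (v - u) ^+ 2 = (u - v) ^+ 2 by ring.
    by have := sqr_ge0 (u - v); lra.
  - by rewrite mulr_ge0// divr_ge0 ?(ltW s20)//; lra.
have tailE (Z : T -> R) : [set w | Z w <= - u \/ v <= Z w] =
    [set w | Z w <= m - r \/ m + r <= Z w].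
  rewrite /m /r; apply/seteqP.
  by split=> w /= -[] h; [left|right|left|right]; lra.
split; [move=> Z [M uZ] EZ VZ|split].
- have Z2 : (\int[P]_w ((Z w) ^+ 2)%:E = 1%:E)%E by rewrite -variance_centered.
  have [z [EZz shift]] := second_moment_shift Z2.
  have z0 : z = 0 by move: EZz; rewrite EZ => -[].
  have Zm : (\int[P]_w ((Z w - m) ^+ 2)%:E = (1 + m ^+ 2)%:E)%E.
    by rewrite shift z0 mulr0 subr0.
  have -> : [set w | (Z w <= - u)%R \/ (v <= Z w)%R] =
      [set w | (r <= `|Z w - m|)%R].
    rewrite tailE; apply/seteqP; split=> w /=; rewrite ler_normr.
      by case=> h; apply/orP; [right|left]; lra.
    by move=> /orP[] h; [right|left]; lra.
  apply: (le_trans (vysochanskij_petunin (unimodal_spread uZ) Zm r0)).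
  have B1 : 4 / 9 * ((1 + m ^+ 2) / r ^+ 2) = bound.
    by rewrite /bound /m /r; field.
  (* At [3 / 8] the two terms of the maximum agree. *)
  have B2 : (1 + m ^+ 2) / r ^+ 2 <= 3 / 8.
    by rewrite ler_pdivrMr ?exprn_gt0// /m /r; lra.
  by rewrite lee_fin ge_max -B1 lexx/=; lra.
- exact: nonneg.
move=> U Y Z UY U01 Ym Y0 Yp ZE.
have a0 : 0 < a by rewrite /a; lra.
have [pm0 p00 pp0] := nonneg.
have p1 : pm + p0 + pp = 1 by rewrite /pm /p0 /pp; field.
have [EZ VZ] : ('E_P[Z] = 0)%E /\ ('V_P[Z] = 1)%E.
  apply: mean_variance_shift => c.
  rewrite (three_point_second_moment a0 pm0 p00 pp0 p1 UY U01 Ym Y0 Yp ZE).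
  by congr EFin; rewrite /m /a /pm /pp; field.
split=> //.
  exact: (three_point_unimodal a0 pm0 pp0 p1 UY U01 Ym Y0 Yp ZE).
rewrite tailE (three_point_tail a0 p1 UY U01 Ym Y0 Yp ZE).
  by congr EFin; rewrite /bound /r /a /pm /pp; field.
by rewrite r0/= /r /a; lra.
Qed.
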